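(* Let $p>1$ and $\lambda\le 0$. There exists a sign-changing periodic solution of the equation $$u''-uu'+u|u|^{p-1}-\lambda u=0\quad\text{in }\mathbb{R}.$$
   Context: A solution is a real-valued function of class $\mathcal{C}^2$ satisfying the equation in the classical sense. It is sign-changing if it takes both positive and negative values. *)

(* Defs.v *)
(* Stdlib real numbers with Coquelicot. *)
From Stdlib Require Import Reals.
From Coquelicot Require Import Coquelicot.

Local Open Scope R_scope.

Definition class_C2 (u : R -> R) : Prop :=
  (forall x : R, ex_derive u x) /\
  (forall x : R, ex_derive (Derive u) x) /\
  (forall x : R, continuous (Derive_n u 2) x).

(* [Rpower 0 y] is [1] in Stdlib; here it is multiplied by [u x = 0], so the
   nonlinearity u|u|^(p-1) takes its usual value 0 at the zeros of [u]. *)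
Definition is_solution (p lambda : R) (u : R -> R) : Prop :=
  class_C2 u /\
  forall x : R,
    Derive_n u 2 x - u x * Derive u x
      + u x * Rpower (Rabs (u x)) (p - 1) - lambda * u x = 0.

Definition sign_changing (u : R -> R) : Prop :=
  (exists x : R, 0 < u x) /\ (exists x : R, u x < 0).

Definition periodic (u : R -> R) : Prop :=
  exists T : R, 0 < T /\ forall x : R, u (x + T) = u x.

(* Main.v *)
(* With [tau] the truncation of the identity at height [a], the truncated
   equation [u'' = tau(u) u' - force(tau(u))] is a planar Lipschitz system in
   the Lienard variables [(u, u' - T(u))], where [T' = tau]; hence its solutions
   are global and unique. It is invariant under [u(t) -> -u(2c - t)], so a
   solution is antisymmetric about each of its zeros, and a solution with two
   zeros [c1 < c2] has period [2 (c2 - c1)]. It therefore suffices that the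
   solution with [u(0) = a], [u'(0) = 0] vanishes on both sides of 0 and that
   [0 <= u <= a] between these zeros, where the truncation has no effect. Forward
   in time, for every [a], [u'] would stay below a negative constant if [u]
   stayed positive. Backward in time the term [u u'] acts as friction, and 0 is reached as soon as
   [4 a^(p-1) > (p-1) a^2]: take [a] small, arbitrary or large according as
   [p < 3], [p = 3] or [p > 3]. *)
Require Import Defs.
From Stdlib Require Import Reals ZArith Lra Lia Classical.
From Coquelicot Require Import Coquelicot.

Local Open Scope R_scope.

(** * Monotonicity from derivatives, weighted integral bounds and geometric convergence *)

Lemma is_derive_mean_value (f df : R -> R) (a b : R) :
  a <= b ->
  (forall x, a <= x <= b -> is_derive f x (df x)) ->
  exists c, a <= c <= b /\ f b - f a = df c * (b - a).
Proof.
  intros Hab Hd.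
  destruct (MVT_gen f a b df) as [c Hc];
    try (rewrite Rmin_left, Rmax_right in * by lra).
  - intros x Hx. apply Hd; lra.
  - intros x Hx. apply continuity_pt_filterlim, (ex_derive_continuous f).
    exists (df x). apply Hd; lra.
  - now exists c.
Qed.

Lemma is_derive_nonneg_le (f df : R -> R) (a b : R) :
  a <= b ->
  (forall x, a <= x <= b -> is_derive f x (df x)) ->
  (forall x, a <= x <= b -> 0 <= df x) ->
  f a <= f b.
Proof.
  intros Hab Hd Hp. destruct (is_derive_mean_value f df a b Hab Hd) as [c [Hc E]].
  specialize (Hp c Hc). nra.
Qed.

Lemma is_derive_pos_lt (f df : R -> R) (a b : R) :
  a < b ->
  (forall x, a <= x <= b -> is_derive f x (df x)) ->
  (forall x, a <= x <= b -> 0 < df x) ->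
  f a < f b.
Proof.
  intros Hab Hd Hp. destruct (is_derive_mean_value f df a b) as [c [Hc E]]; [lra|easy|].
  specialize (Hp c Hc). nra.
Qed.

Lemma is_derive_primitive (f : R -> R) (a t : R) :
  (forall s, continuous f s) -> is_derive (fun x => RInt f a x) t (f t).
Proof.
  intros Hf. apply (is_derive_RInt f (fun x => RInt f a x) a); [|apply Hf].
  apply filter_forall. intros x. apply (RInt_correct f).
  apply (ex_RInt_continuous f). intros; apply Hf.
Qed.

Lemma cosh_ge_1 (x : R) : 1 <= cosh x.
Proof.
  unfold cosh. pose proof (exp_ineq1_le x). pose proof (exp_ineq1_le (- x)). lra.
Qed.

(** [B / L * sinh (L x)] plus or minus the integral of [f] is nondecreasing and vanishes at 0, and
    [sinh] is at most [cosh] in absolute value. Integration thus gains a factor [1 / L] in the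
    [cosh] weight, for both signs of [t]. *)
Lemma Rabs_RInt_cosh_le (f : R -> R) (B L t : R) :
  0 < L -> (forall s, continuous f s) ->
  (forall s, Rabs (f s) <= B * cosh (L * s)) ->
  Rabs (RInt f 0 t) <= B / L * cosh (L * t).
Proof.
  intros HL Hc Hb.
  assert (HB : 0 <= B).
  { pose proof (Hb 0). pose proof (Rabs_pos (f 0)). pose proof (cosh_ge_1 (L * 0)). nra. }
  assert (Hs : forall e x, is_derive (fun x => B / L * sinh (L * x) - e * RInt f 0 x) x
                           (B * cosh (L * x) - e * f x)).
  { intros e x.
    apply (is_derive_minus (fun x => B / L * sinh (L * x)) (fun x => e * RInt f 0 x)).
    - unfold sinh, cosh. auto_derive; [easy|]. field. lra.
    - apply (is_derive_scal (fun x => RInt f 0 x)). now apply is_derive_primitive. }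
  assert (Hm : forall e a b, Rabs e <= 1 -> a <= b ->
    B / L * sinh (L * a) - e * RInt f 0 a <= B / L * sinh (L * b) - e * RInt f 0 b).
  { intros e a b He Hab.
    apply (is_derive_nonneg_le (fun x => B / L * sinh (L * x) - e * RInt f 0 x)
      (fun x => B * cosh (L * x) - e * f x)); [exact Hab| |].
    - intros x _. apply Hs.
    - intros x _. simpl. pose proof (Hb x) as H.
      pose proof (Rle_abs (e * f x)) as H1. rewrite Rabs_mult in H1.
      pose proof (Rabs_pos (f x)). nra. }
  assert (H0 : RInt f 0 0 = 0) by apply (RInt_point 0 f).
  assert (HS0 : sinh (L * 0) = 0) by (rewrite Rmult_0_r; apply sinh_0).
  assert (E1 : Rabs 1 <= 1) by (apply Rabs_le; lra).
  assert (E2 : Rabs (-1) <= 1) by (apply Rabs_le; lra).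
  assert (Hq : 0 <= B / L) by (apply Rdiv_le_0_compat; lra).
  assert (Hsc : Rabs (sinh (L * t)) <= cosh (L * t)).
  { unfold sinh, cosh. pose proof (exp_pos (L * t)). pose proof (exp_pos (- (L * t))).
    apply Rabs_le; lra. }
  apply Rabs_le_between in Hsc.
  apply Rabs_le.
  destruct (Rle_dec 0 t) as [Ht|Ht].
  - pose proof (Hm 1 0 t E1 Ht) as A1. pose proof (Hm (-1) 0 t E2 Ht) as A2.
    rewrite H0, HS0 in A1, A2. nra.
  - assert (Ht' : t <= 0) by lra.
    pose proof (Hm 1 t 0 E1 Ht') as A1. pose proof (Hm (-1) t 0 E2 Ht') as A2.
    rewrite H0, HS0 in A1, A2. nra.
Qed.

Lemma is_lim_seq_half_pow (M : R) : is_lim_seq (fun n => M * (1 / 2) ^ n) 0.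
Proof.
  replace (Finite 0) with (Rbar_mult M 0) by (simpl; f_equal; ring).
  apply (is_lim_seq_scal_l (fun n => (1 / 2) ^ n) M 0).
  apply is_lim_seq_geom. apply Rabs_def1; lra.
Qed.

Lemma geometric_cauchy_lim (a : nat -> R) (D : R) :
  (forall n, Rabs (a (S n) - a n) <= D * (1 / 2) ^ n) ->
  exists l, forall n, Rabs (l - a n) <= 2 * D * (1 / 2) ^ n.
Proof.
  intros Ha.
  assert (Hpos : forall n, 0 < (1 / 2) ^ n) by (intros n; apply pow_lt; lra).
  assert (HD : 0 <= D).
  { pose proof (Ha 0%nat). pose proof (Rabs_pos (a 1%nat - a 0%nat)). simpl in *; lra. }
  (* The exact partial geometric sum is kept on the right so that the induction on [k] closes. *)
  assert (Hk : forall n k, Rabs (a (n + k)%nat - a n) <= 2 * D * ((1 / 2) ^ n - (1 / 2) ^ (n + k))).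
  { intros n k. induction k as [|k IH].
    - rewrite Nat.add_0_r, Rminus_diag, Rabs_R0. lra.
    - rewrite Nat.add_succ_r. pose proof (Ha (n + k)%nat).
      replace (a (S (n + k)) - a n)
        with ((a (S (n + k)) - a (n + k)%nat) + (a (n + k)%nat - a n)) by ring.
      eapply Rle_trans; [apply Rabs_triang|]. simpl. lra. }
  assert (Hk' : forall n k, Rabs (a (n + k)%nat - a n) <= 2 * D * (1 / 2) ^ n).
  { intros n k. eapply Rle_trans; [apply Hk|]. pose proof (Hpos (n + k)%nat). nra. }
  pose proof (is_lim_seq_half_pow (4 * D)) as Hlim.
  assert (Hex : ex_finite_lim_seq a).
  { apply ex_lim_seq_cauchy_corr. intros eps.
    apply is_lim_seq_spec in Hlim. destruct (Hlim eps) as [N HN].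
    exists N. intros n m Hn Hm. specialize (HN N (Nat.le_refl _)).
    rewrite Rminus_0_r in HN. apply Rabs_def2 in HN.
    replace n with (N + (n - N))%nat by (rewrite Nat.add_comm; now apply Nat.sub_add).
    replace m with (N + (m - N))%nat by (rewrite Nat.add_comm; now apply Nat.sub_add).
    pose proof (Hk' N (n - N)%nat) as A1. pose proof (Hk' N (m - N)%nat) as A2.
    set (x := a (N + (n - N))%nat) in *. set (y := a (N + (m - N))%nat) in *.
    replace (x - y) with ((x - a N) - (y - a N)) by ring.
    unfold Rminus at 1. eapply Rle_lt_trans; [apply Rabs_triang|]. rewrite Rabs_Ropp. lra. }
  destruct Hex as [l Hl]. exists l. intros n.
  assert (Hl' : is_lim_seq (fun k => Rabs (a (k + n)%nat - a n)) (Rabs (l - a n))).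
  { apply (is_lim_seq_abs (fun k => a (k + n)%nat - a n) (l - a n)).
    apply is_lim_seq_minus'; [|apply is_lim_seq_const].
    now apply is_lim_seq_incr_n. }
  refine (is_lim_seq_le _ _ (Finite _) (Finite _) _ Hl' (is_lim_seq_const _)).
  intros k. rewrite Nat.add_comm. apply Hk'.
Qed.

(** * Global solutions of planar Lipschitz systems *)

(** Points of the plane are functions on [bool]. Since [d] is any common bound on the two coordinate
    differences, this is the Lipschitz condition in the sup norm. *)
Definition lipschitz_field (F : bool -> (bool -> R) -> R) (K : R) : Prop :=
  forall i x y d, (forall j, Rabs (x j - y j) <= d) -> Rabs (F i x - F i y) <= K * d.

Definition solves (F : bool -> (bool -> R) -> R) (X : bool -> R -> R) : Prop :=
  forall i t, is_derive (X i) t (F i (fun j => X j t)).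

Lemma lipschitz_field_continuous F K (X : bool -> R -> R) i t :
  0 < K -> lipschitz_field F K -> (forall j, continuous (X j) t) ->
  continuous (fun s => F i (fun j => X j s)) t.
Proof.
  intros HK HF HX. apply filterlim_locally. intros eps.
  assert (He : 0 < eps / (2 * K)).
  { apply Rdiv_lt_0_compat; [apply cond_pos|lra]. }
  pose proof (proj1 (filterlim_locally _ _) (HX true) (mkposreal _ He)) as A1.
  pose proof (proj1 (filterlim_locally _ _) (HX false) (mkposreal _ He)) as A2.
  generalize (filter_and _ _ A1 A2). apply filter_imp.
  intros s [B1 B2].
  change (Rabs (F i (fun j => X j s) - F i (fun j => X j t)) < eps).
  change (Rabs (X true s - X true t) < eps / (2 * K)) in B1.
  change (Rabs (X false s - X false t) < eps / (2 * K)) in B2.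
  eapply Rle_lt_trans.
  - apply HF with (d := eps / (2 * K)). intros [|]; lra.
  - replace (K * (eps / (2 * K))) with (eps / 2) by (field; lra).
    pose proof (cond_pos eps). lra.
Qed.

Fixpoint picard (F : bool -> (bool -> R) -> R) (x0 : bool -> R) (n : nat) (i : bool) (t : R) : R :=
  match n with
  | O => x0 i
  | S n => x0 i + RInt (fun s => F i (fun j => picard F x0 n j s)) 0 t
  end.

Lemma picard_continuous F K x0 n i t :
  0 < K -> lipschitz_field F K -> continuous (picard F x0 n i) t.
Proof.
  intros HK HF. revert i t. induction n as [|n IH]; intros i t; simpl.
  - apply continuous_const.
  - apply (continuous_plus (fun _ => x0 i)); [apply continuous_const|].
    eapply (ex_derive_continuous (fun t => RInt (fun s => F i (fun j => picard F x0 n j s)) 0 t)).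
    eexists. apply is_derive_primitive.
    intros s. eapply lipschitz_field_continuous; eauto.
Qed.

(* The weight [cosh (2 K t)] makes one Picard step a contraction by 1/2. *)
Lemma RInt_field_diff F K (X Y : bool -> R -> R) i t B :
  0 < K -> lipschitz_field F K ->
  (forall j s, continuous (X j) s) -> (forall j s, continuous (Y j) s) ->
  (forall j s, Rabs (X j s - Y j s) <= B * cosh (2 * K * s)) ->
  Rabs (RInt (fun s => F i (fun j => X j s)) 0 t - RInt (fun s => F i (fun j => Y j s)) 0 t)
    <= B / 2 * cosh (2 * K * t).
Proof.
  intros HK HF HX HY HB.
  assert (CX : forall s, continuous (fun s => F i (fun j => X j s)) s)
    by (intros s; eapply lipschitz_field_continuous; eauto).
  assert (CY : forall s, continuous (fun s => F i (fun j => Y j s)) s)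
    by (intros s; eapply lipschitz_field_continuous; eauto).
  rewrite <- (RInt_minus (fun s => F i (fun j => X j s)) (fun s => F i (fun j => Y j s)))
    by (apply (ex_RInt_continuous (V := R_CompleteNormedModule)); auto).
  replace (B / 2) with (K * B / (2 * K)) by (field; lra).
  apply Rabs_RInt_cosh_le; [lra| |].
  - intros s. now apply (continuous_minus (V := R_NormedModule)).
  - intros s. rewrite Rmult_assoc. apply HF. intros j. apply HB.
Qed.

Lemma picard_step F K x0 :
  0 < K -> lipschitz_field F K ->
  exists C, forall n i t,
    Rabs (picard F x0 (S n) i t - picard F x0 n i t) <= C * cosh (2 * K * t) * (1 / 2) ^ n.
Proof.
  (* The first increment is the integral of the constant [F i x0], bounded by [B], hence by
     [B * cosh]; every later step halves the bound. *)
  intros HK HF. set (B := Rabs (F true x0) + Rabs (F false x0)).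
  exists (B / (2 * K)). induction n as [|n IH]; intros i t.
  - replace (picard F x0 1 i t - picard F x0 0 i t) with (RInt (fun _ => F i x0) 0 t)
      by (symmetry; apply Rplus_minus_l).
    simpl pow. rewrite Rmult_1_r. apply Rabs_RInt_cosh_le; [lra| |].
    + intros s. apply continuous_const.
    + intros s. pose proof (cosh_ge_1 (2 * K * s)). unfold B.
      pose proof (Rabs_pos (F true x0)). pose proof (Rabs_pos (F false x0)).
      destruct i; nra.
  - change (picard F x0 (S (S n)) i t)
      with (x0 i + RInt (fun s => F i (fun j => picard F x0 (S n) j s)) 0 t).
    change (picard F x0 (S n) i t)
      with (x0 i + RInt (fun s => F i (fun j => picard F x0 n j s)) 0 t).
    set (I1 := RInt _ 0 t). set (I2 := RInt _ 0 t).
    replace (x0 i + I1 - (x0 i + I2)) with (I1 - I2) by ring.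
    replace (B / (2 * K) * cosh (2 * K * t) * (1 / 2) ^ S n)
      with (B / (2 * K) * (1 / 2) ^ n / 2 * cosh (2 * K * t)) by (simpl; field; lra).
    unfold I1, I2. apply RInt_field_diff; auto.
    + intros j s. eapply picard_continuous; eauto.
    + intros j s. eapply picard_continuous; eauto.
    + intros j s. eapply Rle_trans; [apply IH|]. right; ring.
Qed.

(** The Picard iterates converge at a geometric rate in the [cosh] weight, hence locally uniformly
    on the whole line. The limit is continuous, solves the integral equation, and is therefore
    differentiable. *)
Lemma lipschitz_ode_exists F K x0 :
  0 < K -> lipschitz_field F K ->
  exists X, solves F X /\ forall i, X i 0 = x0 i.
Proof.
  intros HK HF. destruct (picard_step F K x0 HK HF) as [C HC].
  set (X := fun i t => real (Lim_seq (fun n => picard F x0 n i t))).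
  assert (HX : forall n i t, Rabs (X i t - picard F x0 n i t)
                             <= 2 * C * (1 / 2) ^ n * cosh (2 * K * t)).
  { intros n i t.
    destruct (geometric_cauchy_lim (fun n => picard F x0 n i t) (C * cosh (2 * K * t))) as [l Hl].
    - intros k. apply HC.
    - replace (X i t) with l.
      + eapply Rle_trans; [apply Hl|]. right; ring.
      + symmetry. unfold X.
        rewrite (is_lim_seq_unique _ l); [easy|].
        apply is_lim_seq_spec. intros eps.
        pose proof (is_lim_seq_half_pow (2 * (C * cosh (2 * K * t)))) as Hg.
        apply is_lim_seq_spec in Hg. destruct (Hg eps) as [N HN]. exists N.
        intros k Hk. rewrite Rabs_minus_sym. eapply Rle_lt_trans; [apply Hl|].
        specialize (HN k Hk). rewrite Rminus_0_r in HN. now apply Rabs_def2 in HN. }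
  assert (HC0 : 0 <= C).
  { pose proof (HC 0%nat true 0) as H. rewrite Rmult_0_r, cosh_0 in H.
    pose proof (Rabs_pos (picard F x0 1 true 0 - picard F x0 0 true 0)). simpl in *; lra. }
  assert (Hsmall : forall M eps, 0 < eps -> exists n, M * (1 / 2) ^ n < eps).
  { intros M eps He.
    pose proof (is_lim_seq_half_pow M) as Hg.
    apply is_lim_seq_spec in Hg. destruct (Hg (mkposreal _ He)) as [N HN]. exists N.
    specialize (HN N (Nat.le_refl _)). rewrite Rminus_0_r in HN. now apply Rabs_def2 in HN. }
  (* A three-epsilon argument: near [t] the weight is at most its value at [t] plus 1, which makes
     the error of one iterate uniform there. *)
  assert (CX : forall i t, continuous (X i) t).
  { intros i t. apply filterlim_locally. intros eps.
    destruct (Hsmall (2 * C * (cosh (2 * K * t) + 1)) (eps / 3)) as [n Hn].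
    { pose proof (cond_pos eps). lra. }
    assert (He : 0 < eps / 3) by (pose proof (cond_pos eps); lra).
    pose proof (proj1 (filterlim_locally _ _) (picard_continuous F K x0 n i t HK HF) (mkposreal _ He)) as A1.
    assert (A2 : continuous (fun s => cosh (2 * K * s)) t).
    { apply (ex_derive_continuous (fun s => cosh (2 * K * s))). unfold cosh. auto_derive. easy. }
    pose proof (proj1 (filterlim_locally _ _) A2 (mkposreal _ Rlt_0_1)) as A3.
    generalize (filter_and _ _ A1 A3). apply filter_imp. intros s [B1 B2].
    change (Rabs (picard F x0 n i s - picard F x0 n i t) < eps / 3) in B1.
    change (Rabs (cosh (2 * K * s) - cosh (2 * K * t)) < 1) in B2.
    change (Rabs (X i s - X i t) < eps).
    pose proof (HX n i s) as H1. pose proof (HX n i t) as H2.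
    apply Rabs_def2 in B1. apply Rabs_def2 in B2.
    apply Rabs_le_between in H1. apply Rabs_le_between in H2.
    assert (0 < (1 / 2) ^ n) by (apply pow_lt; lra).
    assert (2 * C * (1 / 2) ^ n * cosh (2 * K * s) <= 2 * C * (1 / 2) ^ n * (cosh (2 * K * t) + 1)).
    { apply Rmult_le_compat_l; [nra|lra]. }
    assert (2 * C * (1 / 2) ^ n * cosh (2 * K * t) <= 2 * C * (1 / 2) ^ n * (cosh (2 * K * t) + 1)).
    { apply Rmult_le_compat_l; [nra|lra]. }
    apply Rabs_def1; lra. }
  assert (CF : forall i s, continuous (fun s => F i (fun j => X j s)) s)
    by (intros i s; eapply lipschitz_field_continuous; eauto).
  (* For every [n], both sides lie within [C * (1 / 2) ^ n * cosh (2 * K * t)] of the iterate of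
     index [S n]. *)
  assert (Hint : forall i t, X i t = x0 i + RInt (fun s => F i (fun j => X j s)) 0 t).
  { intros i t. apply Rminus_diag_uniq. apply Rabs_eq_0.
    apply Rle_antisym; [|apply Rabs_pos]. apply Rnot_lt_le. intros Hlt.
    destruct (Hsmall (2 * C * cosh (2 * K * t)) _ Hlt) as [n Hn].
    apply (Rlt_irrefl (Rabs (X i t - (x0 i + RInt (fun s => F i (fun j => X j s)) 0 t)))).
    eapply Rle_lt_trans; [|exact Hn].
    pose proof (HX (S n) i t) as H1.
    change (picard F x0 (S n) i t)
      with (x0 i + RInt (fun s => F i (fun j => picard F x0 n j s)) 0 t) in H1.
    assert (H2 := RInt_field_diff F K X (picard F x0 n) i t (2 * C * (1 / 2) ^ n) HK HF CX
      (fun j s => picard_continuous F K x0 n j s HK HF) (fun j s => HX n j s)).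
    apply Rabs_le_between in H1. apply Rabs_le_between in H2. simpl in H1.
    apply Rabs_le. lra. }
  exists X. split.
  - intros i t.
    apply (is_derive_ext (fun t => x0 i + RInt (fun s => F i (fun j => X j s)) 0 t)).
    { intros s. now rewrite <- Hint. }
    replace (F i (fun j => X j t)) with (plus 0 (F i (fun j => X j t)))
      by (unfold plus; simpl; ring).
    apply (is_derive_plus (fun _ => x0 i)).
    + apply is_derive_Reals, derivable_pt_lim_const.
    + apply (is_derive_primitive (fun s => F i (fun j => X j s))). apply CF.
  - intros i. rewrite Hint. rewrite (RInt_point 0 (fun s => F i (fun j => X j s))).
    unfold zero; simpl; ring.
Qed.

(** Gronwall's argument for the squared distance [D]: from [|D'| <= 4 K D], the product
    [exp (-4 K t) D] is nonincreasing and [exp (4 K t) D] is nondecreasing. The first gives [D <= 0]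
    after [t0], the second before it. *)
Lemma lipschitz_ode_unique F K X Y t0 :
  0 < K -> lipschitz_field F K -> solves F X -> solves F Y ->
  (forall i, X i t0 = Y i t0) -> forall i t, X i t = Y i t.
Proof.
  intros HK HF HX HY H0.
  set (D := fun t => (X true t - Y true t) ^ 2 + (X false t - Y false t) ^ 2).
  set (dD := fun t =>
    2 * (X true t - Y true t) * (F true (fun j => X j t) - F true (fun j => Y j t))
    + 2 * (X false t - Y false t) * (F false (fun j => X j t) - F false (fun j => Y j t))).
  assert (HD : forall e t, is_derive (fun t => exp (e * t) * D t) t (exp (e * t) * (e * D t + dD t))).
  { intros e t. unfold D, dD.
    pose proof (HX true t) as A1. pose proof (HX false t) as A2.
    pose proof (HY true t) as A3. pose proof (HY false t) as A4.
    auto_derive.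
    - repeat split; eexists; eassumption.
    - rewrite (is_derive_unique (fun t : R => X true t) _ _ A1),
        (is_derive_unique (fun t : R => X false t) _ _ A2),
        (is_derive_unique (fun t : R => Y true t) _ _ A3),
        (is_derive_unique (fun t : R => Y false t) _ _ A4). ring. }
  assert (Hbd : forall t, Rabs (dD t) <= 4 * K * D t).
  { intros t.
    set (a := X true t - Y true t). set (b := X false t - Y false t).
    assert (Hd : forall i, Rabs (F i (fun j => X j t) - F i (fun j => Y j t)) <= K * sqrt (D t)).
    { intros i. apply HF. intros j. rewrite <- sqrt_Rsqr_abs. apply sqrt_le_1_alt.
      unfold D, Rsqr. destruct j; fold a b; pose proof (pow2_ge_0 a); pose proof (pow2_ge_0 b); nra. }
    assert (Hs : sqrt (D t) * sqrt (D t) = D t).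
    { apply sqrt_sqrt. unfold D. fold a b. nra. }
    assert (Ha : Rabs a <= sqrt (D t)).
    { rewrite <- sqrt_Rsqr_abs. apply sqrt_le_1_alt. unfold D, Rsqr. fold a b. nra. }
    assert (Hb : Rabs b <= sqrt (D t)).
    { rewrite <- sqrt_Rsqr_abs. apply sqrt_le_1_alt. unfold D, Rsqr. fold a b. nra. }
    pose proof (Hd true) as H1. pose proof (Hd false) as H2.
    unfold dD. fold a b.
    eapply Rle_trans; [apply Rabs_triang|]. rewrite !Rabs_mult, (Rabs_pos_eq 2) by lra.
    pose proof (Rmult_le_compat _ _ _ _ (Rabs_pos _) (Rabs_pos _) Ha H1).
    pose proof (Rmult_le_compat _ _ _ _ (Rabs_pos _) (Rabs_pos _) Hb H2).
    rewrite <- Hs. lra. }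
  assert (D0 : D t0 = 0).
  { unfold D. rewrite !H0. ring. }
  assert (Dz : forall t, D t <= 0).
  { intros t. destruct (Rle_dec t0 t) as [Ht|Ht].
    - assert (H : exp (- (4 * K) * t0) * - D t0 <= exp (- (4 * K) * t) * - D t).
      { apply (is_derive_nonneg_le (fun t => exp (- (4 * K) * t) * - D t)
          (fun t => exp (- (4 * K) * t) * (4 * K * D t - dD t))); [lra| |].
        - intros x _.
          apply (is_derive_ext (fun t => - (exp (- (4 * K) * t) * D t))); [intros; simpl; ring|].
          replace (exp (- (4 * K) * x) * (4 * K * D x - dD x))
            with (- (exp (- (4 * K) * x) * (- (4 * K) * D x + dD x))) by ring.
          apply (is_derive_opp (fun t => exp (- (4 * K) * t) * D t)), HD.
        - intros x _. pose proof (Hbd x) as H. apply Rabs_le_between in H.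
          apply Rmult_le_pos; [left; apply exp_pos|lra]. }
      rewrite D0 in H. pose proof (exp_pos (- (4 * K) * t)). nra.
    - assert (H : exp (4 * K * t) * D t <= exp (4 * K * t0) * D t0).
      { apply (is_derive_nonneg_le (fun t => exp (4 * K * t) * D t)
          (fun t => exp (4 * K * t) * (4 * K * D t + dD t))); [lra| |].
        - intros x _. apply HD.
        - intros x _. pose proof (Hbd x) as H. apply Rabs_le_between in H.
          apply Rmult_le_pos; [left; apply exp_pos|lra]. }
      rewrite D0 in H. pose proof (exp_pos (4 * K * t)). nra. }
  intros i t. pose proof (Dz t) as H. unfold D in H.
  pose proof (pow2_ge_0 (X true t - Y true t)). pose proof (pow2_ge_0 (X false t - Y false t)).
  apply Rminus_diag_uniq. apply Rsqr_0_uniq. unfold Rsqr. destruct i; lra.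
Qed.

(** * The truncated nonlinearity *)

Definition clamp (a x : R) : R := Rmax (- a) (Rmin a x).

Ltac unfold_clamp := unfold clamp, Rmax, Rmin; repeat destruct Rle_dec.

Lemma clamp_bounds a x : 0 <= a -> - a <= clamp a x <= a.
Proof. intros Ha. unfold_clamp; lra. Qed.

Lemma clamp_id a x : - a <= x <= a -> clamp a x = x.
Proof. intros Ha. unfold_clamp; lra. Qed.

Lemma clamp_opp a x : 0 <= a -> clamp a (- x) = - clamp a x.
Proof. intros Ha. unfold_clamp; lra. Qed.

Lemma clamp_nonneg a x : 0 <= a -> 0 <= x -> 0 <= clamp a x.
Proof. intros Ha Hx. unfold_clamp; lra. Qed.

Lemma clamp_pos a x : 0 < a -> 0 < x -> 0 < clamp a x.
Proof. intros Ha Hx. unfold_clamp; lra. Qed.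

Lemma clamp_lipschitz a x y : 0 <= a -> Rabs (clamp a x - clamp a y) <= Rabs (x - y).
Proof.
  intros Ha. unfold_clamp; unfold Rabs; repeat destruct Rcase_abs; lra.
Qed.

Lemma lipschitz_continuous (f : R -> R) (K : R) :
  0 < K -> (forall x y, Rabs (f x - f y) <= K * Rabs (x - y)) -> forall x, continuous f x.
Proof.
  intros HK Hf x. apply filterlim_locally. intros eps.
  assert (He : 0 < eps / K) by (apply Rdiv_lt_0_compat; [apply cond_pos|lra]).
  exists (mkposreal _ He). intros y Hy.
  change (Rabs (y - x) < eps / K) in Hy. change (Rabs (f y - f x) < eps).
  eapply Rle_lt_trans; [apply Hf|].
  apply (Rmult_lt_compat_l K) in Hy; [|lra].
  replace (K * (eps / K)) with (pos eps) in Hy by (field; lra). lra.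
Qed.

Lemma clamp_continuous a x : 0 <= a -> continuous (clamp a) x.
Proof.
  intros Ha. apply (lipschitz_continuous _ 1); [lra|].
  intros y z. rewrite Rmult_1_l. now apply clamp_lipschitz.
Qed.

(** The primitive [T] of the truncation; it equals [x^2 / 2] on [[-a, a]]. *)
Definition clamp_int (a x : R) : R := RInt (clamp a) 0 x.

Lemma is_derive_clamp_int a x : 0 <= a -> is_derive (clamp_int a) x (clamp a x).
Proof.
  intros Ha. apply (is_derive_primitive (clamp a)). intros s. now apply clamp_continuous.
Qed.

Lemma clamp_int_opp a x : 0 <= a -> clamp_int a (- x) = clamp_int a x.
Proof.
  intros Ha. unfold clamp_int.
  assert (H : is_RInt (clamp a) (- 0) (- x) (RInt (clamp a) 0 (- x))).
  { rewrite Ropp_0. apply (RInt_correct (clamp a)).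
    apply (ex_RInt_continuous (clamp a)). intros; now apply clamp_continuous. }
  apply is_RInt_comp_opp in H.
  apply (is_RInt_ext _ (clamp a)) in H.
  - symmetry. now apply is_RInt_unique.
  - intros s _. rewrite clamp_opp by lra. unfold opp; simpl; ring.
Qed.

Lemma clamp_int_lipschitz a x y :
  0 <= a -> Rabs (clamp_int a x - clamp_int a y) <= a * Rabs (x - y).
Proof.
  intros Ha.
  destruct (MVT_gen (clamp_int a) y x (clamp a)) as [c [_ E]].
  - intros z _. now apply is_derive_clamp_int.
  - intros z _. apply continuity_pt_filterlim, (ex_derive_continuous (clamp_int a)).
    eexists. now apply is_derive_clamp_int.
  - rewrite E, Rabs_mult. apply Rmult_le_compat_r; [apply Rabs_pos|].
    apply Rabs_le, clamp_bounds; lra.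
Qed.

(** With this odd function the equation reads [u'' = u u' - force u]. *)
Definition force (p lambda x : R) : R := x * Rpower (Rabs x) (p - 1) - lambda * x.

Lemma force_opp p lambda x : force p lambda (- x) = - force p lambda x.
Proof. unfold force. rewrite Rabs_Ropp. ring. Qed.

Lemma Rpower_shift x p : 0 < x -> x * Rpower x (p - 1) = Rpower x p.
Proof.
  intros Hx. rewrite <- (Rpower_1 x Hx) at 1. rewrite <- Rpower_plus. f_equal; ring.
Qed.

Lemma force_ge p lambda x :
  lambda <= 0 -> 0 < x -> x * Rpower x (p - 1) <= force p lambda x.
Proof.
  intros Hl Hx. unfold force. rewrite (Rabs_pos_eq x) by lra. nra.
Qed.

Lemma force_pos p lambda x : lambda <= 0 -> 0 < x -> 0 < force p lambda x.
Proof.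
  intros Hl Hx. eapply Rlt_le_trans; [|now apply force_ge].
  apply Rmult_lt_0_compat; [easy|apply exp_pos].
Qed.

Lemma force_0 p lambda : force p lambda 0 = 0.
Proof. unfold force. ring. Qed.

Lemma force_nonneg p lambda x : lambda <= 0 -> 0 <= x -> 0 <= force p lambda x.
Proof.
  intros Hl [Hx| <-]; [left; now apply force_pos|rewrite force_0; lra].
Qed.

Lemma power_lipschitz_nonneg p a x y :
  1 < p -> 0 <= x -> x <= y -> y <= a ->
  0 <= y * Rpower (Rabs y) (p - 1) - x * Rpower (Rabs x) (p - 1)
    <= p * Rpower a (p - 1) * (y - x).
Proof.
  intros Hp Hx Hxy Hya.
  rewrite !Rabs_pos_eq by lra.
  (* [Rpower] is differentiable only at positive arguments, so the mean value theorem serves for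
     [0 < x], and [x = 0] is compared directly using [1 < p]. *)
  destruct Hx as [Hx| <-].
  - rewrite !Rpower_shift by lra.
    destruct (MVT_gen (fun x => Rpower x p) x y (fun x => p * Rpower x (p - 1))) as [c [Hc E]].
    + intros z Hz. rewrite Rmin_left, Rmax_right in Hz by lra.
      apply is_derive_Reals, derivable_pt_lim_power. lra.
    + intros z Hz. rewrite Rmin_left, Rmax_right in Hz by lra.
      apply derivable_continuous_pt. eexists. apply derivable_pt_lim_power. lra.
    + rewrite Rmin_left, Rmax_right in Hc by lra. rewrite E.
      assert (H1 : 0 < Rpower c (p - 1)) by apply exp_pos.
      assert (H2 : Rpower c (p - 1) <= Rpower a (p - 1)) by (apply Rle_Rpower_l; lra).
      split.
      * apply Rmult_le_pos; [|lra]. apply Rmult_le_pos; lra.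
      * apply Rmult_le_compat_r; [lra|]. apply Rmult_le_compat_l; lra.
  - rewrite Rmult_0_l, !Rminus_0_r. destruct Hxy as [Hy| <-].
    + assert (H1 : 0 < Rpower y (p - 1)) by apply exp_pos.
      assert (H2 : Rpower y (p - 1) <= Rpower a (p - 1)) by (apply Rle_Rpower_l; lra).
      split; [nra|].
      assert (Rpower a (p - 1) <= p * Rpower a (p - 1)) by nra. nra.
    + lra.
Qed.

(** Oddness reduces the power term to nonnegative arguments: two negative points are reflected, and
    an interval containing 0 is split there. *)
Lemma force_lipschitz p lambda a x y :
  1 < p -> lambda <= 0 -> - a <= x <= a -> - a <= y <= a ->
  Rabs (force p lambda x - force p lambda y)
    <= (p * Rpower a (p - 1) - lambda) * Rabs (x - y).
Proof.
  intros Hp Hl.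
  assert (Hle : forall x y, - a <= x -> x <= y -> y <= a ->
    0 <= y * Rpower (Rabs y) (p - 1) - x * Rpower (Rabs x) (p - 1)
      <= p * Rpower a (p - 1) * (y - x)).
  { clear x y. intros x y Hx Hxy Hy.
    destruct (Rle_dec 0 x) as [H0x|H0x]; [apply power_lipschitz_nonneg; lra|].
    destruct (Rle_dec 0 y) as [H0y|H0y].
    - pose proof (power_lipschitz_nonneg p a 0 y Hp ltac:(lra) ltac:(lra) ltac:(lra)) as H1.
      pose proof (power_lipschitz_nonneg p a 0 (- x) Hp ltac:(lra) ltac:(lra) ltac:(lra)) as H2.
      rewrite Rabs_Ropp in H2. lra.
    - pose proof (power_lipschitz_nonneg p a (- y) (- x) Hp ltac:(lra) ltac:(lra) ltac:(lra)) as H2.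
      rewrite !Rabs_Ropp in H2. lra. }
  intros Hx Hy. unfold force.
  destruct (Rle_dec x y) as [Hxy|Hxy].
  - pose proof (Hle x y ltac:(lra) ltac:(lra) ltac:(lra)).
    rewrite (Rabs_left1 (x - y)) by lra. apply Rabs_le. nra.
  - pose proof (Hle y x ltac:(lra) ltac:(lra) ltac:(lra)).
    rewrite (Rabs_pos_eq (x - y)) by lra. apply Rabs_le. nra.
Qed.

(* Lienard coordinates: component [true] is [u], component [false] is
   [u' - clamp_int a u], so that no product of unbounded quantities appears. *)
Definition lienard (p lambda a : R) (i : bool) (x : bool -> R) : R :=
  if i then x false + clamp_int a (x true) else - force p lambda (clamp a (x true)).

Lemma lienard_lipschitz p lambda a :
  1 < p -> lambda <= 0 -> 0 < a ->
  exists K, 0 < K /\ lipschitz_field (lienard p lambda a) K.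
Proof.
  intros Hp Hl Ha.
  assert (Hpow : 0 < p * Rpower a (p - 1)) by (apply Rmult_lt_0_compat; [lra|apply exp_pos]).
  (* The summands come from the coordinate [x false], from [clamp_int], and from [force] composed
     with the 1-Lipschitz [clamp]. *)
  exists (1 + a + (p * Rpower a (p - 1) - lambda)). split; [lra|].
  intros i x y d Hd.
  assert (Hd0 : 0 <= d) by (eapply Rle_trans; [apply Rabs_pos|apply (Hd true)]).
  pose proof (Hd true) as Ht. pose proof (Hd false) as Hf.
  destruct i; unfold lienard.
  - pose proof (clamp_int_lipschitz a (x true) (y true) ltac:(lra)) as H1.
    replace (x false + clamp_int a (x true) - (y false + clamp_int a (y true)))
      with ((x false - y false) + (clamp_int a (x true) - clamp_int a (y true))) by ring.
    eapply Rle_trans; [apply Rabs_triang|]. nra.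
  - pose proof (force_lipschitz p lambda a (clamp a (x true)) (clamp a (y true)) Hp Hl
      (clamp_bounds a _ (Rlt_le _ _ Ha)) (clamp_bounds a _ (Rlt_le _ _ Ha))) as H1.
    pose proof (clamp_lipschitz a (x true) (y true) ltac:(lra)) as H2.
    replace (- force p lambda (clamp a (x true)) - - force p lambda (clamp a (y true)))
      with (- (force p lambda (clamp a (x true)) - force p lambda (clamp a (y true)))) by ring.
    rewrite Rabs_Ropp. nra.
Qed.

(** Under [u(t) -> -u(2c - t)] the derivative becomes [u'(2c - t)] and the even function [clamp_int]
    of [u] is only time-reversed, so the second coordinate keeps its sign. The oddness of [clamp]
    and [force] then matches the second equation. *)
Lemma lienard_reflect p lambda a X c :
  0 < a -> solves (lienard p lambda a) X ->
  solves (lienard p lambda a)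
    (fun i t => if i then - X true (2 * c - t) else X false (2 * c - t)).
Proof.
  intros Ha HX i t.
  assert (Hd : forall j, is_derive (fun t => X j (2 * c - t)) t
                 (- lienard p lambda a j (fun j => X j (2 * c - t)))).
  { intros j.
    replace (- lienard p lambda a j (fun j => X j (2 * c - t)))
      with (scal (-1) (lienard p lambda a j (fun j => X j (2 * c - t))))
      by (unfold scal; simpl; unfold mult; simpl; ring).
    apply (is_derive_comp (X j) (fun t => 2 * c - t)); [apply HX|].
    auto_derive; [easy|ring]. }
  destruct i.
  - replace (lienard _ _ _ _ _) with (- - lienard p lambda a true (fun j => X j (2 * c - t))).
    + apply (is_derive_opp (fun t => X true (2 * c - t))), Hd.
    + unfold lienard. rewrite clamp_int_opp by lra. ring.
  - replace (lienard _ _ _ _ _) with (- lienard p lambda a false (fun j => X j (2 * c - t))).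
    + apply Hd.
    + unfold lienard. rewrite clamp_opp, force_opp by lra. ring.
Qed.

(** At [t = c] the solution and its reflection agree in both coordinates, so uniqueness identifies
    them. *)
Lemma lienard_antisym p lambda a X c :
  1 < p -> lambda <= 0 -> 0 < a -> solves (lienard p lambda a) X -> X true c = 0 ->
  forall t, X true t = - X true (2 * c - t).
Proof.
  intros Hp Hl Ha HX Hc t.
  destruct (lienard_lipschitz p lambda a Hp Hl Ha) as [K [HK HF]].
  apply (lipschitz_ode_unique _ K X
    (fun i t => if i then - X true (2 * c - t) else X false (2 * c - t)) c HK HF HX
    (lienard_reflect _ _ _ _ _ Ha HX)).
  intros [|]; replace (2 * c - c) with c by ring; [rewrite Hc; ring|easy].
Qed.

(** * Zeros on both sides of the maximum *)

(** The first zero is the supremum [T] of the times up to which [f] stays positive. If [f T < 0],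
    [f] would be negative just before [T]; if [f T > 0], positivity would extend past [T]. *)
Lemma first_nonpos (f : R -> R) (b : R) :
  (forall x, continuous f x) -> 0 < f 0 -> 0 <= b -> f b <= 0 ->
  exists t, 0 < t /\ f t = 0 /\ forall s, 0 <= s < t -> 0 < f s.
Proof.
  intros Hc H0 Hb Hfb.
  set (E := fun t => 0 <= t /\ forall s, 0 <= s <= t -> 0 < f s).
  assert (HE0 : E 0).
  { split; [lra|]. intros s Hs. now replace s with 0 by lra. }
  destruct (completeness E) as [T [HT1 HT2]].
  - exists b. intros t [Ht Hs]. apply Rnot_lt_le. intros Hbt.
    specialize (Hs b ltac:(lra)). lra.
  - now exists 0.
  - assert (HT0 : 0 <= T) by now apply HT1.
    assert (Hbelow : forall s, 0 <= s < T -> 0 < f s).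
    { intros s Hs. apply Rnot_le_lt. intros Hfs.
      apply (Rlt_irrefl T). eapply Rle_lt_trans; [|apply Hs].
      apply HT2. intros t [Ht Hts]. apply Rnot_lt_le. intros Hst.
      specialize (Hts s ltac:(lra)). lra. }
    assert (Hnear : forall e : posreal, exists d : posreal, forall y, Rabs (y - T) < d ->
              Rabs (f y - f T) < e).
    { intros e. destruct (proj1 (filterlim_locally _ _) (Hc T) e) as [d Hd].
      exists d. intros y Hy. now apply Hd. }
    assert (HfT : f T = 0).
    { destruct (Rtotal_order (f T) 0) as [Hn|[He|Hp]]; [exfalso|easy|exfalso].
      - assert (Hm : 0 < - f T) by lra.
        destruct (Hnear (mkposreal _ Hm)) as [d Hd]. simpl in Hd.
        pose proof (cond_pos d) as Hdp.
        assert (HTp : 0 < T).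
        { destruct HT0 as [HT0| <-]; lra. }
        set (y := Rmax 0 (T - d / 2)).
        assert (Hy : 0 <= y < T /\ T - d / 2 <= y) by (unfold y, Rmax; destruct Rle_dec; lra).
        specialize (Hbelow y (proj1 Hy)).
        specialize (Hd y ltac:(apply Rabs_def1; lra)). apply Rabs_def2 in Hd. lra.
      - destruct (Hnear (mkposreal _ Hp)) as [d Hd]. simpl in Hd.
        pose proof (cond_pos d) as Hdp.
        assert (HE : E (T + d / 2)).
        { split; [lra|]. intros s Hs. destruct (Rlt_dec s T) as [HsT|HsT].
          - apply Hbelow; lra.
          - specialize (Hd s ltac:(apply Rabs_def1; lra)). apply Rabs_def2 in Hd. lra. }
        apply HT1 in HE. lra. }
    exists T. repeat split; try easy.
    destruct HT0 as [HT0|HT0]; [easy|]. rewrite <- HT0 in HfT. lra.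
Qed.

Definition is_truncated_orbit (p lambda a : R) (u v : R -> R) : Prop :=
  (forall t, is_derive u t (v t)) /\
  (forall t, is_derive v t (clamp a (u t) * v t - force p lambda (clamp a (u t)))) /\
  u 0 = a /\ v 0 = 0.

(** Its negative is the exponent of the integrating factor for [v' = clamp a u * v - force], read as
    a linear equation in [v]. *)
Definition damping (a : R) (u : R -> R) (t : R) : R := RInt (fun s => clamp a (u s)) 0 t.

Lemma is_derive_damping a (u : R -> R) t :
  0 < a -> (forall s, ex_derive u s) -> is_derive (damping a u) t (clamp a (u t)).
Proof.
  intros Ha Hu. apply (is_derive_primitive (fun s => clamp a (u s))). intros s.
  apply (continuous_comp u (clamp a)).
  - apply (ex_derive_continuous u), Hu.
  - apply clamp_continuous; lra.
Qed.

Lemma is_derive_damped_speed p lambda a u v t :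
  0 < a -> is_truncated_orbit p lambda a u v ->
  is_derive (fun t => - (v t * exp (- damping a u t))) t
    (force p lambda (clamp a (u t)) * exp (- damping a u t)).
Proof.
  intros Ha (Hu & Hv & _).
  pose proof (is_derive_damping a u t Ha (fun s => ex_intro _ _ (Hu s))) as H1.
  pose proof (Hv t) as H2.
  auto_derive.
  - repeat split; eexists; eassumption.
  - rewrite (is_derive_unique (fun x : R => v x) _ _ H2).
    rewrite (is_derive_unique (fun x : R => damping a u x) _ _ H1). ring.
Qed.

(** While [u >= 0], the quantity [- v * exp (- damping)] is nondecreasing, and it vanishes at time
    0. The product [t * v t] treats past and future at once. *)
Lemma orbit_speed_sign p lambda a u v t :
  0 < a -> lambda <= 0 -> is_truncated_orbit p lambda a u v ->
  (forall s, Rmin 0 t <= s <= Rmax 0 t -> 0 <= u s) ->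
  t * v t <= 0.
Proof.
  intros Ha Hl Ho Hpos.
  assert (Hm : forall x y, Rmin 0 t <= x -> x <= y -> y <= Rmax 0 t ->
    - (v x * exp (- damping a u x)) <= - (v y * exp (- damping a u y))).
  { intros x y Hx Hxy Hy.
    apply (is_derive_nonneg_le (fun t => - (v t * exp (- damping a u t)))
      (fun t => force p lambda (clamp a (u t)) * exp (- damping a u t))); [easy| |].
    - intros z _. now apply is_derive_damped_speed.
    - intros z Hz. apply Rmult_le_pos; [|left; apply exp_pos].
      apply force_nonneg, clamp_nonneg; [lra|lra|]. apply Hpos; lra. }
  destruct Ho as (_ & _ & _ & Hv0).
  pose proof (exp_pos (- damping a u t)) as He.
  destruct (Rle_dec 0 t) as [Ht|Ht].
  - specialize (Hm 0 t). rewrite Rmin_left, Rmax_right, Hv0 in Hm by lra.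
    specialize (Hm ltac:(lra) ltac:(lra) ltac:(lra)).
    assert (v t <= 0) by nra. nra.
  - specialize (Hm t 0). rewrite Rmin_right, Rmax_left, Hv0 in Hm by lra.
    specialize (Hm ltac:(lra) ltac:(lra) ltac:(lra)).
    assert (0 <= v t) by nra. nra.
Qed.

(** By the sign of the speed, [u] rises before time 0 and falls after it, so its maximum is
    [u 0 = a]. *)
Lemma orbit_nonneg_le p lambda a u v t :
  0 < a -> lambda <= 0 -> is_truncated_orbit p lambda a u v ->
  (forall s, Rmin 0 t <= s <= Rmax 0 t -> 0 <= u s) ->
  u t <= a.
Proof.
  intros Ha Hl Ho Hpos. pose proof Ho as (Hu & _ & Hu0 & _).
  rewrite <- Hu0. destruct (Rle_dec 0 t) as [Ht|Ht].
  - rewrite Rmin_left, Rmax_right in Hpos by lra.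
    apply Ropp_le_cancel.
    apply (is_derive_nonneg_le (fun t => - u t) (fun t => - v t)); [easy| |].
    + intros x _. apply (is_derive_opp u), Hu.
    + intros x Hx.
      assert (H : x * v x <= 0).
      { apply (orbit_speed_sign p lambda a u v x Ha Hl Ho). intros s. rewrite Rmin_left, Rmax_right by lra.
        intros; apply Hpos; lra. }
      destruct (proj1 Hx) as [Hx0| <-]; [nra|]. destruct Ho as (_ & _ & _ & ->). lra.
  - rewrite Rmin_right, Rmax_left in Hpos by lra.
    apply (is_derive_nonneg_le u v); [lra| |].
    + intros x _. apply Hu.
    + intros x Hx.
      assert (H : x * v x <= 0).
      { apply (orbit_speed_sign p lambda a u v x Ha Hl Ho). intros s. rewrite Rmin_right, Rmax_left by lra.
        intros; apply Hpos; lra. }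
      destruct (proj2 Hx) as [Hx0| ->]; [nra|]. destruct Ho as (_ & _ & _ & ->). lra.
Qed.

Lemma forward_nonpos p lambda a u v :
  0 < a -> lambda <= 0 -> is_truncated_orbit p lambda a u v ->
  exists t, 0 <= t /\ u t <= 0.
Proof.
  intros Ha Hl Ho. apply NNPP. intros Hn.
  assert (Hpos : forall t, 0 <= t -> 0 < u t).
  { intros t Ht. apply Rnot_le_lt. intros H. apply Hn. now exists t. }
  pose proof Ho as (Hu & Hv & Hu0 & Hv0).
  set (w := fun t => - (v t * exp (- damping a u t))).
  assert (Hw : forall x, is_derive w x (force p lambda (clamp a (u x)) * exp (- damping a u x)))
    by (intros; now apply is_derive_damped_speed).
  assert (Hw' : forall x, 0 <= x -> 0 < force p lambda (clamp a (u x)) * exp (- damping a u x)).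
  { intros x Hx. apply Rmult_lt_0_compat; [|apply exp_pos].
    apply force_pos, clamp_pos; auto. }
  (* [w] increases strictly from [w 0 = 0]. As [damping >= 0] in the future, [- v >= w >= c] from
     time 1 on. *)
  set (c := w 1).
  assert (Hc : 0 < c).
  { replace 0 with (w 0) by (unfold w; rewrite Hv0; ring).
    eapply is_derive_pos_lt; [lra|intros; apply Hw|intros; apply Hw'; lra]. }
  assert (Hcv : forall t, 1 <= t -> c <= - v t).
  { intros t Ht.
    assert (H1 : c <= w t).
    { eapply is_derive_nonneg_le; [exact Ht|intros; apply Hw|].
      intros x Hx. left. apply Hw'; lra. }
    assert (H2 : 0 <= damping a u t).
    { replace 0 with (damping a u 0) by apply (RInt_point 0 (fun s => clamp a (u s))).
      apply (is_derive_nonneg_le (damping a u) (fun t => clamp a (u t))); [lra| |].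
      - intros x _. apply is_derive_damping; [easy|]. intros s. now exists (v s).
      - intros x Hx. apply clamp_nonneg; [lra|]. left. apply Hpos; lra. }
    assert (H3 : exp (- damping a u t) <= 1).
    { rewrite <- exp_0. destruct H2 as [H2|H2].
      - left. apply exp_increasing. lra.
      - rewrite <- H2, Ropp_0. lra. }
    pose proof (exp_pos (- damping a u t)). unfold w in H1. nra. }
  (* Time at which the line of slope [- c] through [(1, u 1)], which lies above [u], reaches 0. *)
  set (T := 1 + u 1 / c).
  assert (HT : 1 <= T).
  { unfold T. pose proof (Hpos 1 ltac:(lra)).
    assert (0 < u 1 / c) by (apply Rdiv_lt_0_compat; lra). lra. }
  assert (H : - u 1 - c * 1 <= - u T - c * T).
  { apply (is_derive_nonneg_le (fun t => - u t - c * t) (fun t => - v t - c)); [easy| |].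
    - intros x _. apply (is_derive_minus (fun t => - u t) (fun t => c * t)).
      + apply (is_derive_opp u), Hu.
      + auto_derive; [easy|ring].
    - intros x Hx. specialize (Hcv x (proj1 Hx)). lra. }
  assert (Ec : c * T = c + u 1) by (unfold T; field; lra).
  pose proof (Hpos T ltac:(lra)). lra.
Qed.

(* If [u] stays positive in the past, either [v - u^2/2], which does not
   increase with time, becomes positive and then bounds [v] from below; or
   [v <= u^2/2] throughout, so that [v - u^2/2 + 2/(p-1) u^(p-1)] does not
   increase either, and the condition on [a] (this quantity is positive at
   time [0]) keeps [u], hence also the decay rate of [v - u^2/2], away from 0. *)
Lemma backward_nonpos p lambda a u v :
  1 < p -> 0 < a -> lambda <= 0 -> is_truncated_orbit p lambda a u v ->
  a ^ 2 / 2 < 2 / (p - 1) * Rpower a (p - 1) ->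
  exists t, t <= 0 /\ u t <= 0.
Proof.
  intros Hp Ha Hl Ho Hcond. apply NNPP. intros Hn.
  assert (Hpos : forall t, t <= 0 -> 0 < u t).
  { intros t Ht. apply Rnot_le_lt. intros H. apply Hn. now exists t. }
  pose proof Ho as (Hu & Hv & Hu0 & Hv0).
  assert (Hua : forall t, t <= 0 -> u t <= a).
  { intros t Ht. apply (orbit_nonneg_le p lambda a u v t); trivial. intros s Hs.
    rewrite Rmax_left in Hs by lra. left. apply Hpos; lra. }
  set (m := fun t => v t - u t ^ 2 / 2).
  assert (Hm : forall t, t <= 0 -> is_derive m t (- force p lambda (u t))).
  { intros t Ht. pose proof (Hu t) as H1. pose proof (Hv t) as H2. unfold m.
    auto_derive.
    - repeat split; eexists; eassumption.
    - rewrite (is_derive_unique (fun x : R => v x) _ _ H2).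
      rewrite (is_derive_unique (fun x : R => u x) _ _ H1).
      rewrite clamp_id; [field|]. pose proof (Hpos t Ht). pose proof (Hua t Ht). lra. }
  destruct (classic (exists t0, t0 <= 0 /\ 0 < m t0)) as [[t0 [Ht0 Hm0]]|Hneg].
  - assert (Hvm : forall t, t <= t0 -> m t0 <= v t).
    { intros t Ht. apply Rle_trans with (m t).
      - apply Ropp_le_cancel.
        apply (is_derive_nonneg_le (fun t => - m t) (fun t => force p lambda (u t))); [easy| |].
        + intros x Hx. rewrite <- (Ropp_involutive (force _ _ _)).
          apply (is_derive_opp m), Hm. lra.
        + intros x Hx. left. apply force_pos, Hpos; lra.
      - unfold m. pose proof (pow2_ge_0 (u t)). lra. }
    (* Going back from [t0], [u] lies below the line of slope [m t0] through [(t0, u t0)], which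
       vanishes at [T]. *)
    set (T := t0 - u t0 / m t0).
    pose proof (Hpos t0 Ht0) as Hp0.
    assert (HT : T < t0).
    { unfold T. assert (0 < u t0 / m t0) by (apply Rdiv_lt_0_compat; lra). lra. }
    assert (H : u T - m t0 * T <= u t0 - m t0 * t0).
    { apply (is_derive_nonneg_le (fun t => u t - m t0 * t) (fun t => v t - m t0)); [lra| |].
      - intros x _. apply (is_derive_minus u (fun t => m t0 * t)); [apply Hu|].
        auto_derive; [easy|ring].
      - intros x Hx. specialize (Hvm x (proj2 Hx)). lra. }
    assert (E : m t0 * T = m t0 * t0 - u t0) by (unfold T; field; lra).
    pose proof (Hpos T ltac:(lra)). lra.
  - assert (Hmn : forall t, t <= 0 -> m t <= 0).
    { intros t Ht. apply Rnot_lt_le. intros H. apply Hneg. now exists t. }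
    set (Q := fun t => m t + 2 / (p - 1) * Rpower (u t) (p - 1)).
    assert (HQ : forall t, t <= 0 ->
      is_derive Q t (- force p lambda (u t) + 2 * (Rpower (u t) (p - 1 - 1) * v t))).
    { intros t Ht. apply (is_derive_plus m (fun t => 2 / (p - 1) * Rpower (u t) (p - 1))).
      - now apply Hm.
      - replace (2 * (Rpower (u t) (p - 1 - 1) * v t))
          with (2 / (p - 1) * (v t * ((p - 1) * Rpower (u t) (p - 1 - 1)))) by (field; lra).
        apply (is_derive_scal (fun t => Rpower (u t) (p - 1))).
        apply (is_derive_comp (fun x => Rpower x (p - 1)) u); [|apply Hu].
        apply is_derive_Reals, derivable_pt_lim_power. now apply Hpos. }
    set (d := Q 0).
    assert (Hd : 0 < d).
    { unfold d, Q, m. rewrite Hu0, Hv0. lra. }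
    assert (HdQ : forall t, t <= 0 -> d <= Q t).
    { intros t Ht. apply Ropp_le_cancel.
      apply (is_derive_nonneg_le (fun t => - Q t) (fun t =>
        - (- force p lambda (u t) + 2 * (Rpower (u t) (p - 1 - 1) * v t)))); [easy| |].
      - intros x Hx. apply (is_derive_opp Q), HQ. lra.
      - intros x Hx. pose proof (Hpos x (proj2 Hx)) as Hux.
        pose proof (Hmn x (proj2 Hx)) as Hmx. unfold m in Hmx.
        pose proof (force_ge p lambda (u x) Hl Hux) as Hf.
        (* Splits [u^p] as [u * (u * u^(p-2))], so that [v <= u^2 / 2] yields
           [2 u^(p-2) v <= u^p <= force], that is, [Q' <= 0]. *)
        rewrite <- (Rpower_shift (u x) (p - 1) Hux) in Hf.
        assert (H1 : 0 < Rpower (u x) (p - 1 - 1)) by apply exp_pos.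
        assert (H2 : Rpower (u x) (p - 1 - 1) * v x
                     <= Rpower (u x) (p - 1 - 1) * (u x ^ 2 / 2))
          by (apply Rmult_le_compat_l; lra).
        lra. }
    (* Because [m <= 0] and [Q >= d], the power term of [Q] alone is at least [d]; solving for
       [u^(p-1)] gives [e]. *)
    set (e := d * (p - 1) / 2).
    assert (He : 0 < e) by (unfold e; nra).
    assert (Hpow : forall t, t <= 0 -> e <= Rpower (u t) (p - 1)).
    { intros t Ht. pose proof (HdQ t Ht) as H1. pose proof (Hmn t Ht) as H2. unfold Q in H1.
      replace (Rpower (u t) (p - 1))
        with (2 / (p - 1) * Rpower (u t) (p - 1) * ((p - 1) / 2)) by (field; lra).
      unfold e. nra. }
    set (b := Rpower e (/ (p - 1))).
    assert (Hb : 0 < b) by apply exp_pos.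
    assert (Hbu : forall t, t <= 0 -> b <= u t).
    { intros t Ht. apply Rnot_lt_le. intros Hlt.
      pose proof (Hpos t Ht) as Hut.
      assert (Hlt' : Rpower (u t) (p - 1) < Rpower b (p - 1)) by (apply Rlt_Rpower_l; lra).
      unfold b in Hlt'. rewrite Rpower_mult, Rinv_l, Rpower_1 in Hlt' by lra.
      specialize (Hpow t Ht). lra. }
    set (k := b * e).
    assert (Hk : 0 < k) by (unfold k; nra).
    (* Going back, [m] grows at rate at least [k], so [m T >= 1], against [m <= 0]. *)
    set (T := (m 0 - 1) / k).
    assert (HT : T <= 0).
    { pose proof (Hmn 0 ltac:(lra)). unfold T.
      replace ((m 0 - 1) / k) with (- ((1 - m 0) / k)) by (field; lra).
      assert (0 < (1 - m 0) / k) by (apply Rdiv_lt_0_compat; lra). lra. }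
    assert (H : - m T - k * T <= - m 0 - k * 0).
    { apply (is_derive_nonneg_le (fun t => - m t - k * t)
        (fun t => - - force p lambda (u t) - k)); [easy| |].
      - intros x Hx. apply (is_derive_minus (fun t => - m t) (fun t => k * t)).
        + apply (is_derive_opp m), Hm. lra.
        + auto_derive; [easy|ring].
      - intros x Hx. pose proof (Hpos x (proj2 Hx)) as Hux.
        pose proof (force_ge p lambda (u x) Hl Hux) as Hf.
        pose proof (Hbu x (proj2 Hx)) as H1. pose proof (Hpow x (proj2 Hx)) as H2.
        assert (b * e <= u x * Rpower (u x) (p - 1)) by (apply Rmult_le_compat; lra).
        unfold k. lra. }
    assert (E : k * T = m 0 - 1) by (unfold T; field; lra).
    pose proof (Hmn T HT). lra.
Qed.

(** Division by [a^2] turns the condition into [(p-1)/4 < a^(p-3)]. For [p = 3] this reads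
    [1/2 < 1]; otherwise [a] is chosen with [a^(p-3) = p/4]. *)
Lemma exists_amplitude p :
  1 < p -> exists a, 0 < a /\ a ^ 2 / 2 < 2 / (p - 1) * Rpower a (p - 1).
Proof.
  intros Hp.
  assert (H : exists a, 0 < a /\ (p - 1) / 4 < Rpower a (p - 3)).
  { destruct (Req_dec p 3) as [->|H3].
    - exists 1. split; [lra|]. rewrite Rminus_diag, Rpower_O; lra.
    - exists (Rpower (p / 4) (/ (p - 3))). split; [apply exp_pos|].
      rewrite Rpower_mult, Rinv_l, Rpower_1; lra. }
  destruct H as [a [Ha H]]. exists a. split; [easy|].
  replace (p - 1) with (p - 3 + INR 2) at 2 by (simpl; ring).
  rewrite Rpower_plus, Rpower_pow by easy.
  assert (Ha2 : 0 < a ^ 2) by nra.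
  apply (Rmult_lt_compat_l (2 / (p - 1) * a ^ 2)) in H.
  - replace (2 / (p - 1) * a ^ 2 * ((p - 1) / 4)) with (a ^ 2 / 2) in H by (field; lra). lra.
  - apply Rmult_lt_0_compat; [apply Rdiv_lt_0_compat|]; lra.
Qed.

(** * Periodic continuation and the sign-changing solution *)

Lemma periodic_IZR (u : R -> R) (T : R) :
  (forall x, u (x + T) = u x) -> forall k x, u (x + IZR k * T) = u x.
Proof.
  intros HT.
  assert (Hn : forall n x, u (x + INR n * T) = u x).
  { induction n as [|n IH]; intros x.
    - simpl. f_equal; ring.
    - rewrite S_INR. replace (x + (INR n + 1) * T) with (x + INR n * T + T) by ring.
      now rewrite HT. }
  intros k x. destruct (Z_le_dec 0 k) as [Hk|Hk].
  - rewrite <- (Z2Nat.id k Hk), <- INR_IZR_INZ. apply Hn.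
  - rewrite <- (Hn (Z.to_nat (- k)) (x + IZR k * T)).
    rewrite INR_IZR_INZ, Z2Nat.id by lia. rewrite opp_IZR. f_equal; ring.
Qed.

Theorem theorem2p13 (p lambda : R) (hp : 1 < p) (hlambda : lambda <= 0) :
  exists u : R -> R,
    is_solution p lambda u /\ sign_changing u /\ periodic u.
Proof.
  destruct (exists_amplitude p hp) as [a [Ha Hcond]].
  destruct (lienard_lipschitz p lambda a hp hlambda Ha) as [K [HK HF]].
  (* The second initial coordinate encodes [u'(0) = 0], since [u' = X false + clamp_int a u]. *)
  destruct (lipschitz_ode_exists _ K (fun i => if i then a else - clamp_int a a) HK HF)
    as [X [HX HX0]].
  set (u := X true). set (v := fun t => X false t + clamp_int a (u t)).
  assert (Hu : forall t, is_derive u t (v t)) by (intros t; exact (HX true t)).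
  assert (Hv : forall t, is_derive v t (clamp a (u t) * v t - force p lambda (clamp a (u t)))).
  { intros t.
    replace (clamp a (u t) * v t - force p lambda (clamp a (u t)))
      with (- force p lambda (clamp a (u t)) + v t * clamp a (u t)) by ring.
    apply (is_derive_plus (X false) (fun t => clamp_int a (u t))); [exact (HX false t)|].
    apply (is_derive_comp (clamp_int a) u); [apply is_derive_clamp_int; lra|apply Hu]. }
  assert (Ho : is_truncated_orbit p lambda a u v).
  { refine (conj Hu (conj Hv (conj (HX0 true) _))). unfold v, u. rewrite !HX0. ring. }
  assert (Hu0 : u 0 = a) by apply Ho.
  assert (Cu : forall t, continuous u t).
  { intros t. apply (ex_derive_continuous u). now exists (v t). }
  destruct (forward_nonpos p lambda a u v Ha hlambda Ho) as [b1 [Hb1 Hub1]].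
  destruct (first_nonpos u b1 Cu ltac:(lra) Hb1 Hub1) as [t1 [Ht1 [Hut1 Hpos1]]].
  destruct (backward_nonpos p lambda a u v hp Ha hlambda Ho Hcond) as [b2 [Hb2 Hub2]].
  (* Time reversal gives the last zero [- t2] before 0. *)
  destruct (first_nonpos (fun t => u (- t)) (- b2)) as [t2 [Ht2 [Hut2 Hpos2]]].
  { intros t. apply (continuous_comp Ropp u); [|apply Cu].
    apply (ex_derive_continuous Ropp). auto_derive. easy. }
  { rewrite Ropp_0; lra. }
  { lra. }
  { now rewrite Ropp_involutive. }
  assert (Hnn : forall t, - t2 <= t <= t1 -> 0 <= u t).
  { intros t Ht. destruct (Rle_dec 0 t) as [H|H].
    - destruct (proj2 Ht) as [H1| ->]; [left; apply Hpos1; lra|lra].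
    - destruct (proj1 Ht) as [H1| <-]; [|lra].
      left. rewrite <- (Ropp_involutive t). apply Hpos2; lra. }
  assert (Hle : forall t, - t2 <= t <= t1 -> u t <= a).
  { intros t Ht. apply (orbit_nonneg_le p lambda a u v t); trivial. intros s Hs. apply Hnn.
    unfold Rmin, Rmax in Hs. destruct Rle_dec; lra. }
  pose proof (lienard_antisym p lambda a X t1 hp hlambda Ha HX Hut1) as S1.
  pose proof (lienard_antisym p lambda a X (- t2) hp hlambda Ha HX Hut2) as S2.
  fold u in S1, S2.
  set (P := 2 * (t1 + t2)).
  assert (Hper : forall x, u (x + P) = u x).
  (* The reflections about [t1] and [- t2] compose to the translation by twice the distance of the
     zeros. *)
  { intros x. rewrite S1, (S2 x). do 2 f_equal. unfold P; ring. }
  assert (Hbd : forall x, - a <= u x <= a).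
  (* [up] exceeds its argument by at most 1, so [k - 1] periods must be removed to land in
     [[- t2, - t2 + P)]. There, a point beyond [t1] is reflected about [t1] into [[- t2, t1]]. *)
  { intros x. set (k := up ((x + t2) / P)).
    assert (HP : 0 < P) by (unfold P; lra).
    destruct (archimed ((x + t2) / P)) as [A1 A2]. fold k in A1, A2.
    assert (Ex : x + t2 = (x + t2) / P * P) by (field; lra).
    rewrite <- (periodic_IZR u P Hper (1 - k) x), minus_IZR.
    set (y := x + (1 - IZR k) * P).
    assert (Hy : - t2 <= y < - t2 + P).
    { unfold y. split; nra. }
    destruct (Rle_dec y t1) as [H|H].
    - pose proof (Hnn y ltac:(lra)). pose proof (Hle y ltac:(lra)). lra.
    - rewrite S1. unfold P in Hy.
      pose proof (Hnn (2 * t1 - y) ltac:(lra)). pose proof (Hle (2 * t1 - y) ltac:(lra)). lra. }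
  assert (Du : forall t, Derive u t = v t) by (intros t; apply is_derive_unique, Hu).
  assert (D2 : forall t, Derive_n u 2 t = u t * v t - force p lambda (u t)).
  { intros t. transitivity (Derive v t); [exact (Derive_ext (Derive u) v t Du)|].
    rewrite (is_derive_unique _ _ _ (Hv t)).
    now rewrite clamp_id by apply Hbd. }
  exists u. repeat split.
  - intros x. now exists (v x).
  - intros x. apply (ex_derive_ext v); [intros; symmetry; apply Du|]. eexists. apply Hv.
  - intros x.
    (* [force] is known to be Lipschitz only on [[-a, a]]; composed with [clamp] it is so on the
       whole line. *)
    apply (continuous_ext (fun t => u t * v t - force p lambda (clamp a (u t)))).
    { intros t. rewrite D2. now rewrite clamp_id by apply Hbd. }
    apply (continuous_minus (fun t => u t * v t) (fun t => force p lambda (clamp a (u t)))).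
    + apply (continuous_mult u v); [apply Cu|].
      apply (ex_derive_continuous v). eexists. apply Hv.
    + apply (continuous_comp u (fun x => force p lambda (clamp a x))); [apply Cu|].
      assert (Hpow : 0 < p * Rpower a (p - 1)) by (apply Rmult_lt_0_compat; [lra|apply exp_pos]).
      apply (lipschitz_continuous _ (p * Rpower a (p - 1) - lambda)); [lra|].
      intros y z. eapply Rle_trans.
      * apply (force_lipschitz p lambda a); auto; apply clamp_bounds; lra.
      * apply Rmult_le_compat_l; [lra|]. apply clamp_lipschitz; lra.
  - intros x. rewrite D2, Du. unfold force. ring.
  - exists 0. lra.
  (* The mirror image of the maximum at 0 about the zero [t1], where [u = - a]. *)
  - exists (2 * t1). rewrite S1. replace (2 * t1 - 2 * t1) with 0 by ring. lra.
  - exists P. split; [unfold P; lra|exact Hper].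
Qed.
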